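(* For $p=011$, we have $$C_p(x,y)=\frac{1-2x+2x^2-x^3+x^3y}{(1-x)^3}.$$
   Context: A Catalan word of length $n\geq 1$ is a word $w_1\ldots w_n$ over the non-negative integers with $w_1=0$ and $0\leq w_i\leq w_{i-1}+1$ for $2\leq i\leq n$; the empty word is the unique Catalan word of length $0$. A word $w$ contains the pattern $p=p_1\ldots p_k$ if there are indices $i_1<\cdots<i_k$ such that $w_{i_1}\ldots w_{i_k}$ is order-isomorphic to $p$ (for all $a,b$: $w_{i_a}<w_{i_b}$ iff $p_a<p_b$, and $w_{i_a}=w_{i_b}$ iff $p_a=p_b$); otherwise $w$ avoids $p$. $\mathcal{C}_n(p)$ is the set of Catalan words of length $n$ avoiding $p$. A descent of $w$ is an index $i$ with $w_i>w_{i+1}$. $C_p(x,y)=\sum_{n,k\geq 0}c_{n,k}x^ny^k$, where $c_{n,k}$ is the number of words in $\mathcal{C}_n(p)$ with exactly $k$ descents. *)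

(* Defs.v *)
From HB Require Import structures.
From mathcomp Require Import all_boot all_order all_algebra.
From mathcomp Require Import boolp.

Set Implicit Arguments.
Unset Strict Implicit.
Unset Printing Implicit Defensive.

Import GRing.Theory.
Local Open Scope ring_scope.

Record fps (R : Type) := FPS { fcoef : nat -> R }.

Lemma fpsP (R : Type) (f g : fps R) : fcoef f =1 fcoef g -> f = g.
Proof. by case: f g => [f] [g] /= fg; congr FPS; apply/funext. Qed.

HB.instance Definition _ (R : Type) := gen_eqMixin (fps R).
HB.instance Definition _ (R : Type) := gen_choiceMixin (fps R).

Definition fps_zero (R : zmodType) : fps R := FPS (fun=> 0).
Definition fps_opp (R : zmodType) (f : fps R) : fps R :=
  FPS (fun n => - fcoef f n).
Definition fps_add (R : zmodType) (f g : fps R) : fps R :=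
  FPS (fun n => fcoef f n + fcoef g n).

Lemma fps_addA (R : zmodType) : associative (@fps_add R).
Proof. by move=> f g h; apply: fpsP => n /=; rewrite addrA. Qed.
Lemma fps_addC (R : zmodType) : commutative (@fps_add R).
Proof. by move=> f g; apply: fpsP => n /=; rewrite addrC. Qed.
Lemma fps_add0 (R : zmodType) : left_id (fps_zero R) (@fps_add R).
Proof. by move=> f; apply: fpsP => n /=; rewrite add0r. Qed.
Lemma fps_addN (R : zmodType) :
  left_inverse (fps_zero R) (@fps_opp R) (@fps_add R).
Proof. by move=> f; apply: fpsP => n /=; rewrite addNr. Qed.

HB.instance Definition _ (R : zmodType) := GRing.isZmodule.Build (fps R)
  (@fps_addA R) (@fps_addC R) (@fps_add0 R) (@fps_addN R).

Definition fpsC (R : zmodType) (c : R) : fps R :=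
  FPS (fun n => if n == 0%N then c else 0).
Definition fpsX (R : nzRingType) : fps R := FPS (fun n => (n == 1%N)%:R).
Definition fps_mul (R : nzRingType) (f g : fps R) : fps R :=
  FPS (fun n => \sum_(i < n.+1) fcoef f i * fcoef g (n - i)).

Definition fps_trunc (R : nzRingType) (N : nat) (f : fps R) : {poly R} :=
  \poly_(i < N) fcoef f i.

Lemma fps_mul_trunc (R : nzRingType) (N n : nat) (f g : fps R) : (n < N)%N ->
  fcoef (fps_mul f g) n = (fps_trunc N f * fps_trunc N g)`_n.
Proof.
move=> nN; rewrite coefM /=; apply: eq_bigr => i _.
by rewrite !coef_poly !(leq_ltn_trans _ nN) ?leq_subr // -ltnS.
Qed.

Lemma fps_mulA (R : comNzRingType) : associative (@fps_mul R).
Proof.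
move=> f g h; apply: fpsP => n.
transitivity ((fps_trunc n.+1 f * (fps_trunc n.+1 g * fps_trunc n.+1 h))`_n).
  rewrite coefM; apply: eq_bigr => i _.
  by rewrite coef_poly ltn_ord (@fps_mul_trunc _ n.+1) // ltnS leq_subr.
rewrite mulrA coefM; apply: eq_bigr => i _.
by rewrite (@fps_mul_trunc _ n.+1) // coef_poly ltnS leq_subr.
Qed.
Lemma fps_mulC (R : comNzRingType) : commutative (@fps_mul R).
Proof.
by move=> f g; apply: fpsP => n; rewrite !(@fps_mul_trunc _ n.+1) // mulrC.
Qed.
Lemma fps_mul1 (R : comNzRingType) : left_id (fpsC (1 : R)) (@fps_mul R).
Proof.
move=> f; apply: fpsP => n /=.
rewrite big_ord_recl /= mul1r subn0 big1 ?addr0 // => i _.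
by rewrite mul0r.
Qed.
Lemma fps_mulDl (R : comNzRingType) :
  left_distributive (@fps_mul R) (@fps_add R).
Proof.
move=> f g h; apply: fpsP => n /=; rewrite -big_split.
by apply: eq_bigr => i _; rewrite mulrDl.
Qed.
Lemma fps_one_neq0 (R : comNzRingType) : fpsC (1 : R) != 0.
Proof.
by apply/eqP => /(congr1 (fun f => fcoef f 0)) /= /eqP; rewrite oner_eq0.
Qed.

HB.instance Definition _ (R : comNzRingType) :=
  GRing.Zmodule_isComNzRing.Build (fps R)
    (@fps_mulA R) (@fps_mulC R) (@fps_mul1 R) (@fps_mulDl R) (fps_one_neq0 R).

(* The first n coefficients g_0, ..., g_(n-1) of the inverse g of f, from
   f_0 g_m + f_1 g_(m-1) + ... + f_m g_0 = [m = 0]. *)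
Fixpoint fps_inv_coefs (R : comUnitRingType) (f : fps R) (n : nat) : seq R :=
  if n is m.+1 then
    let s := fps_inv_coefs f m in
    rcons s ((fcoef f 0)^-1 *
             ((m == 0%N)%:R - \sum_(i < m) s`_i * fcoef f (m - i)))
  else [::].

Definition fps_unit (R : comUnitRingType) : {pred fps R} :=
  fun f => fcoef f 0 \is a GRing.unit.
Definition fps_inv (R : comUnitRingType) (f : fps R) : fps R :=
  if f \in @fps_unit R then FPS (fun n => (fps_inv_coefs f n.+1)`_n) else f.

Lemma size_fps_inv_coefs (R : comUnitRingType) (f : fps R) n :
  size (fps_inv_coefs f n) = n.
Proof. by elim: n => //= n IHn; rewrite size_rcons IHn. Qed.

Lemma nth_fps_inv_coefs (R : comUnitRingType) (f : fps R) n i : (i < n)%N ->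
  (fps_inv_coefs f n)`_i = (fps_inv_coefs f i.+1)`_i.
Proof.
elim: n => // n IHn; rewrite ltnS leq_eqVlt => /predU1P[-> //|lt_in].
by rewrite [in LHS]/= nth_rcons size_fps_inv_coefs lt_in IHn.
Qed.

Lemma fps_mulV (R : comUnitRingType) :
  {in @fps_unit R, left_inverse 1 (@fps_inv R) *%R}.
Proof.
move=> f uf; apply: fpsP => n; rewrite /fps_inv uf.
change (\sum_(i < n.+1) (fps_inv_coefs f i.+1)`_i * fcoef f (n - i) =
        (if n == 0%N then 1 else 0)).
rewrite big_ord_recr /= subnn nth_rcons size_fps_inv_coefs ltnn eqxx.
rewrite mulrAC mulVr // mul1r.
under [X in _ - X]eq_bigr => i _ do rewrite nth_fps_inv_coefs //.
by rewrite addrC subrK; case: eqP.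
Qed.
Lemma fps_unitPl (R : comUnitRingType) (f g : fps R) :
  g * f = 1 -> @fps_unit R f.
Proof.
move/(congr1 (fun h => fcoef h 0)).
change (\sum_(i < 1) fcoef g i * fcoef f (0 - i) = 1 ->
        fcoef f 0 \is a GRing.unit).
by rewrite big_ord1 /= => gf; apply/unitrPr; exists (fcoef g 0); rewrite mulrC.
Qed.
Lemma fps_inv_out (R : comUnitRingType) :
  {in [predC @fps_unit R], @fps_inv R =1 id}.
Proof. by move=> f; rewrite inE /= /fps_inv => /negbTE ->. Qed.

HB.instance Definition _ (R : comUnitRingType) :=
  GRing.ComNzRing_hasMulInverse.Build (fps R)
    (@fps_mulV R) (@fps_unitPl R) (@fps_inv_out R).

(** Bivariate series: Z[[x, y]] is encoded as (Z[[y]])[[x]]. *)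
Notation fps_xy := (fps (fps int)).
Definition xvar : fps_xy := fpsX (fps int).
Definition yvar : fps_xy := fpsC (fpsX int).

Definition catalan_word (w : seq nat) : bool :=
  (head 0%N w == 0%N) && sorted (fun a b => b <= a.+1)%N w.

Definition contains (w p : seq nat) : bool :=
  [exists f : {ffun 'I_(size p) -> 'I_(size w)},
     [forall a : 'I_(size p), forall b : 'I_(size p),
        (a < b)%N ==> (f a < f b)%N] &&
     [forall a : 'I_(size p), forall b : 'I_(size p),
        ((nth 0 w (f a) < nth 0 w (f b)) == (nth 0 p a < nth 0 p b))%N &&
        ((nth 0 w (f a) == nth 0 w (f b)) == (nth 0 p a == nth 0 p b))%N]].

Definition avoids (w p : seq nat) : bool := ~~ contains w p.

Definition descents (w : seq nat) : nat :=
  count (fun i => nth 0 w i > nth 0 w i.+1)%N (iota 0 (size w).-1).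

Lemma catalan_word_lt (w : seq nat) :
  catalan_word w -> all (fun a => a < size w)%N w.
Proof.
case: w => //= a s /andP[/= /eqP-> ps] /=.
suff H m t : path (fun a b => b <= a.+1)%N m t ->
    all (fun c => c <= m + size t)%N t by exact: H ps.
elim: t m => //= b t IHt m /andP[bm /IHt bt]; apply/andP; split.
  by rewrite addnS -addSn (leq_trans bm) // leq_addr.
apply: sub_all bt => c cb; apply: leq_trans cb _.
by rewrite addnS -addSn leq_add2r.
Qed.

(* The letters of a Catalan word of length n are all < n (catalan_word_lt),
   so ranging over n.-tuple 'I_n loses no word. *)
Definition catalan_avoiding (n : nat) (p : seq nat) : {set n.-tuple 'I_n} :=
  [set w : n.-tuple 'I_n |
     catalan_word (map val w) && avoids (map val w) p].

Definition catalan_count (p : seq nat) (n k : nat) : nat :=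
  #|[set w in catalan_avoiding n p | descents (map val w) == k]|.

Definition catalan_gf (p : seq nat) : fps_xy :=
  FPS (fun n => FPS (fun k => (catalan_count p n k)%:Z)).

(* Main.v *)
(** The first letter of a nonempty Catalan word is 0, so avoiding 011 means that
    no positive letter is repeated.  Since letters increase by at most 1 at a
    time, every descent then falls to 0 and is final, so the word is
    0^a 1 2 ... m 0^b with a > 0.  Among those of length n > 0 there are n
    without descents and C(n-1, 2) with one, and no word has more.  Multiplying
    by (1 - x)^3 takes third differences of these coefficients. *)

Require Import Defs.
From mathcomp Require Import all_boot all_order all_algebra.
From mathcomp Require Import zify ring.
Local Open Scope ring_scope.

Import GRing.Theory.

(** * Structure of the Catalan words that avoid 011 *)

Section Counting.
Local Open Scope nat_scope.

(** Trades the cardinal of a set of tuples over ['I_n] for the length of an explicit list of words.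
    Each listed word lifts to a tuple because its letters are below its length. *)
Lemma catalan_count_enum p n k (L : seq (seq nat)) : uniq L ->
    (forall w, (w \in L) =
       [&& size w == n, catalan_word w, avoids w p & descents w == k]) ->
  catalan_count p n k = size L.
Proof.
move=> uL memL; rewrite /catalan_count cardE.
set A := [set _ in _ | _].
have inj : injective (fun t : n.-tuple 'I_n => map val t).
  by move=> t u /(inj_map val_inj) /val_inj.
rewrite -(size_map (fun t : n.-tuple 'I_n => map val t)).
apply/perm_size/uniq_perm => //; first by rewrite (map_inj_uniq inj) enum_uniq.
move=> w; rewrite memL; apply/mapP/and4P.
  move=> [t]; rewrite mem_enum !inE => /andP[/andP[cw aw] dw] ->.
  by split=> //; rewrite size_map size_tuple.
move=> [/eqP sw cw aw dw].
have /allP w_lt := catalan_word_lt cw; rewrite sw in w_lt.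
have Ew : map val (pmap (insub : nat -> option 'I_n) w) = w.
  rewrite (pmap_filter (insubK _)); apply/all_filterP/allP => i iw.
  by rewrite /= isSome_insub w_lt.
have st : size (pmap (insub : nat -> option 'I_n) w) == n.
  by rewrite -(size_map val) Ew sw.
by exists (Tuple st); rewrite ?mem_enum ?inE /= Ew ?cw ?aw.
Qed.

Lemma uniq_filter_posP (w : seq nat) :
  reflect (forall i j, i < j < size w -> nth 0 w i = nth 0 w j ->
             nth 0 w i = 0)
          (uniq (filter (leq 1) w)).
Proof.
elim: w => [|x s IHs]; first by apply: ReflectT => i j; rewrite andbF.
apply: (iffP idP) => [us|H].
  have /IHs us' : uniq (filter (leq 1) s).
    by move: us => /=; case: ifP => // _ /= /andP[].
  case=> [|i] [|j] //= lt_j => [xE|]; last exact: us'.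
  apply/eqP; rewrite -leqn0 leqNgt; apply/negP => x_gt0.
  move: us; rewrite /= x_gt0 /= mem_filter x_gt0 xE mem_nth //.
have us : uniq (filter (leq 1) s).
  by apply/IHs => i j lt_j; apply: (H i.+1 j.+1).
rewrite /=; case: ifP => //= x_gt0; rewrite us andbT mem_filter x_gt0 /=.
apply/negP => xs; have /= := H 0 (index x s).+1.
by rewrite !ltnS index_mem xs nth_index // => /(_ isT erefl) x0; rewrite x0 in x_gt0.
Qed.

(** The leading 0 can always play the 0 of the pattern, so any repeated positive letter completes an
    occurrence. Conversely, the two equal letters of an occurrence exceed a third letter, hence are
    positive. *)
Lemma avoids011E (w : seq nat) : head 0 w = 0 ->
  avoids w [:: 0; 1; 1] = uniq (filter (leq 1) w).
Proof.
move=> w0; apply/idP/uniq_filter_posP => [av i j /andP[ij jw] E|H].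
  apply/eqP; apply: contraNT av => wi.
  have w00 : nth 0 w 0 = 0 by rewrite nth0.
  have i_gt0 : 0 < i by case: i wi {ij E} => //; rewrite w00.
  have iw := ltn_trans ij jw; have w_gt0 := ltn_trans i_gt0 iw.
  apply/existsP; exists [ffun a : 'I_3 =>
    nth (Ordinal w_gt0) [:: Ordinal w_gt0; Ordinal iw; Ordinal jw] a].
  apply/andP; split; apply/forallP=> a; apply/forallP=> b; rewrite !ffunE;
   case: a => [[|[|[|]]] //= _]; case: b => [[|[|[|]]] //= _];
   rewrite ?w00 -?E ?eqxx ?ltnn; lia.
apply/existsP => -[f /andP[/forallP f1 /forallP f2]].
have lt12 := forallP (f1 (@Ordinal 3 1 isT)) (@Ordinal 3 2 isT).
have /andP[_ /= /eqP E12] := forallP (f2 (@Ordinal 3 1 isT)) (@Ordinal 3 2 isT).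
have /andP[/= /eqP E01 _] := forallP (f2 (@Ordinal 3 0 isT)) (@Ordinal 3 1 isT).
move/implyP: lt12 => /(_ isT) lt12.
have := H _ _ _ (eqP E12); rewrite lt12 ltn_ord => /(_ isT) E0.
by rewrite E0 ltn0 in E01.
Qed.

Lemma descents_cons a b s :
  descents [:: a, b & s] = (b < a) + descents (b :: s).
Proof. by rewrite /descents /= (iotaDl 1 0) count_map. Qed.

(** The value [a = 0] is allowed so that what follows a leading 0 has this form too. For [m = 0] the
    triple is not determined by the word. *)
Definition unimodal_word a m b := nseq a 0 ++ iota 1 m ++ nseq b 0.

Lemma size_unimodal_word a m b : size (unimodal_word a m b) = a + m + b.
Proof. by rewrite /unimodal_word !size_cat !size_nseq size_iota addnA. Qed.

Lemma count_mem0_unimodal_word a m b :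
  count_mem 0 (unimodal_word a m b) = a + b.
Proof.
rewrite /unimodal_word !count_cat !count_nseq /= !mul1n.
by have /count_memPn-> : 0 \notin iota 1 m by rewrite mem_iota.
Qed.

Lemma catalan_unimodal a m b : catalan_word (unimodal_word a.+1 m b).
Proof.
have z k c : path (fun a b => b <= a.+1) k (nseq c 0).
  by elim: c k => //= c IHc k; apply: IHc.
have it k l : path (fun a b => b <= a.+1) k (iota k.+1 l ++ nseq b 0).
  elim: l k => [|l IHl] k /=; first exact: z.
  by rewrite leqnn IHl.
rewrite /catalan_word /= cat_path z.
have -> : last 0 (nseq a 0) = 0 by elim: a.
exact: it.
Qed.

Lemma avoids011_unimodal a m b :
  avoids (unimodal_word a.+1 m b) [:: 0; 1; 1].
Proof.
rewrite avoids011E // /unimodal_word !filter_cat !filter_nseq /= cats0.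
by rewrite filter_uniq // iota_uniq.
Qed.

Lemma descents_unimodal a m b :
  descents (unimodal_word a.+1 m b) = (0 < m) && (0 < b).
Proof.
have z c : descents (nseq c 0) = 0.
  by elim: c => // -[|c] // IHc; rewrite [LHS]descents_cons IHc.
have it k l : descents (k.+1 :: iota k.+2 l ++ nseq b 0) = (0 < b).
  elim: l k => [|l IHl] k /=; last by rewrite descents_cons IHl ltnNge leqnSn.
  by case: b => // b; rewrite /= descents_cons (z b.+1).
elim: a => [|a IHa]; last by rewrite -IHa [LHS]descents_cons.
case: m => [|m]; first exact: (z b.+1).
by rewrite [LHS]descents_cons it.
Qed.

(** A word can leave 0 only through the letter 1. *)
Lemma catalan_path0_no1 t : path (fun a b => b <= a.+1) 0 t -> 1 \notin t ->
  t = nseq (size t) 0.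
Proof.
elim: t => //= c t IHt /andP[]; case: c => [_|[|//] _ _].
  by rewrite inE /= => pt /(IHt pt) {1}->.
by rewrite inE.
Qed.

(** Induction along the climb: 1, ..., [m.+1] have been read, and the uniqueness hypothesis
    remembers them. The next letter can only be [m.+2], which continues the climb, or 0, after which
    1 is no longer available and only zeros remain. *)
Lemma catalan_path_tail m t : path (fun a b => b <= a.+1) m.+1 t ->
    uniq (iota 1 m.+1 ++ filter (leq 1) t) ->
  exists l b, t = iota m.+2 l ++ nseq b 0.
Proof.
elim: t m => [|c t IHt] m /=; first by exists 0, 0.
case: c => [|c] /=.
  move=> pt /andP[n1 _]; exists 0, (size t).+1.
  rewrite /= -(catalan_path0_no1 _ pt) //.
  by apply: contra n1 => t1; rewrite mem_cat mem_filter t1 orbT.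
rewrite ltnS leq_eqVlt => /andP[/predU1P[->|c_le] pt] u.
  have [|l [b ->]] := IHt _ pt; last by exists l.+1, b.
  by rewrite -[m.+2]addn1 iotaD -catA.
(* Here [c.+1] lies between 1 and [m.+1], so it has already been read. *)
have : uniq (iota 1 m.+1 ++ c.+1 :: filter (leq 1) t) by [].
rewrite cat_uniq => /and3P[_ /hasPn/(_ c.+1)].
by rewrite mem_head mem_iota => /(_ isT) /negP[]; lia.
Qed.

Lemma catalan_path_unimodal t : path (fun a b => b <= a.+1) 0 t ->
    uniq (filter (leq 1) t) ->
  exists a m b, t = unimodal_word a m b.
Proof.
elim: t => [|[|c] t IHt] /=; first by exists 0, 0, 0.
  by move=> /IHt{}IHt /IHt[a [m [b ->]]]; exists a.+1, m, b.
case: c => //= pt u.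
by have [l [b ->]] := catalan_path_tail 0 t pt u; exists 0, l.+1, b.
Qed.

Lemma catalan_avoids011P w :
  reflect (w = [::] \/ exists a m b, w = unimodal_word a.+1 m b)
          (catalan_word w && avoids w [:: 0; 1; 1]).
Proof.
apply: (iffP andP) => [[cw]|[->|[a [m [b ->]]]]].
- case: w cw => [|x s]; first by left.
  move=> /andP[/= /eqP-> ps]; rewrite avoids011E //= => u; right.
  by have [a [m [b ->]]] := catalan_path_unimodal s ps u; exists a, m, b.
- by split=> //; rewrite avoids011E.
- by rewrite catalan_unimodal avoids011_unimodal.
Qed.

(** * Counts by length and number of descents *)

Lemma catalan_count011_0n k : catalan_count [:: 0; 1; 1] 0 k = (k == 0).
Proof.
rewrite (@catalan_count_enum _ _ _ (nseq (k == 0) [::])) ?size_nseq //.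
  by case: eqP.
move=> w; rewrite mem_nseq; case: w => [|x s] /=; last by rewrite andbF.
by rewrite avoids011E // eqxx andbT lt0b eq_sym.
Qed.

Lemma catalan_count011_S0 n : catalan_count [:: 0; 1; 1] n.+1 0 = n.+1.
Proof.
rewrite (@catalan_count_enum _ _ _
  [seq unimodal_word i.+1 (n - i) 0 | i <- iota 0 n.+1]).
- by rewrite size_map size_iota.
- rewrite map_inj_in_uniq ?iota_uniq // => i j _ _.
  by move/(congr1 (count_mem 0)); rewrite !count_mem0_unimodal_word; lia.
- move=> w; apply/mapP/and4P => [[i]|[/eqP sw cw aw /eqP dw]].
    rewrite (mem_iota 0 n.+1) => /= i_lt ->.
    rewrite catalan_unimodal avoids011_unimodal descents_unimodal.
    by rewrite size_unimodal_word andbF; split=> //; lia.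
  have /catalan_avoids011P[w0|[a [m [b wE]]]] :
    catalan_word w && avoids w [:: 0; 1; 1] by rewrite cw.
    by rewrite w0 in sw.
  subst w.
  move: dw sw; rewrite descents_unimodal size_unimodal_word => dw sw.
  (* Without a descent, [m = 0] or [b = 0]. If [m = 0], all letters are 0, and the word is listed
     with [i = n] and an empty climb. *)
  case: m dw sw {cw aw} => [|m] /= dw sw.
    exists n; first by rewrite (mem_iota 0 n.+1); lia.
    rewrite subnn /unimodal_word /= cats0 -nseqD.
    by congr (0 :: nseq _ 0); lia.
  case: b dw sw => // _ sw; exists a; first by rewrite (mem_iota 0 n.+1); lia.
  by congr unimodal_word; lia.
Qed.

(** The words are indexed by pairs [i < j < n]: the climb has [j - i] letters and the last block
    [n - j] zeros, both nonempty, which forces the descent. *)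
Lemma catalan_count011_S1 n : catalan_count [:: 0; 1; 1] n.+1 1 = 'C(n, 2).
Proof.
rewrite (@catalan_count_enum _ _ _
  [seq unimodal_word i.+1 (j - i) (n - j) | j <- iota 0 n, i <- iota 0 j]).
- rewrite size_allpairs_dep -bin2_sum sumnE big_map /index_iota subn0.
  by apply: eq_bigr => j _; rewrite size_iota.
- apply: allpairs_uniq_dep => [|j _|]; rewrite ?iota_uniq //.
  move=> _ _ /allpairsPdep[j [i [+ + ->]]] /allpairsPdep[j' [i' [+ + ->]]] /=.
  rewrite !mem_iota => /= jn ij jn' ij' E.
  (* The position of the first 1 gives [i]; the number of zeros then gives [j]. Writing [j - i] as a
     successor exposes that 1. *)
  have Ei : i = i'.
    move/(congr1 (index 1)): E; rewrite /unimodal_word !index_cat !mem_nseq /=.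
    rewrite !size_nseq.
    have -> : j - i = (j - i).-1.+1 by lia.
    have -> : j' - i' = (j' - i').-1.+1 by lia.
    by rewrite /=; lia.
  have Ej : j = j'.
    by move/(congr1 (count_mem 0)): E; rewrite !count_mem0_unimodal_word; lia.
  by rewrite Ei Ej.
- move=> w; apply/allpairsPdep/and4P => [[j [i [+ + ->]]]|[/eqP sw cw aw /eqP dw]].
    rewrite !mem_iota => /= j_lt i_lt.
    rewrite catalan_unimodal avoids011_unimodal descents_unimodal.
    by rewrite size_unimodal_word; split=> //; lia.
  have /catalan_avoids011P[w0|[a [m [b wE]]]] :
    catalan_word w && avoids w [:: 0; 1; 1] by rewrite cw.
    by rewrite w0 in sw.
  subst w.
  move: dw sw; rewrite descents_unimodal size_unimodal_word => dw sw.
  exists (a + m), a; rewrite !mem_iota; split; try lia.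
  by congr unimodal_word; lia.
Qed.

Lemma catalan_count011_ge2 n k : catalan_count [:: 0; 1; 1] n k.+2 = 0.
Proof.
rewrite (@catalan_count_enum _ _ _ [::]) // => w; rewrite in_nil.
apply/esym/negP => /and4P[_ cw aw dw].
have /catalan_avoids011P[w0|[a [m [b wE]]]] :
  catalan_word w && avoids w [:: 0; 1; 1] by rewrite cw.
  by rewrite w0 in dw.
by rewrite wE descents_unimodal in dw; case: (_ && _) dw.
Qed.

End Counting.

(** * Coefficients of the power series *)

Lemma fcoefD (R : zmodType) (f g : fps R) n :
  fcoef (f + g) n = fcoef f n + fcoef g n.
Proof. by []. Qed.

Lemma fcoefN (R : zmodType) (f : fps R) n : fcoef (- f) n = - fcoef f n.
Proof. by []. Qed.

Lemma fcoef_fpsXM (R : comNzRingType) (f : fps R) n :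
  fcoef (fpsX R * f) n = if n is m.+1 then fcoef f m else 0.
Proof.
change (\sum_(i < n.+1) fcoef (fpsX R) i * fcoef f (n - i) =
  if n is m.+1 then fcoef f m else 0).
rewrite big_ord_recl /= mul0r add0r.
case: n => [|n]; first by rewrite big_ord0.
rewrite big_ord_recl /= mul1r subSS subn0 big1 ?addr0 // => i _.
by rewrite mul0r.
Qed.

Lemma fcoef_natr (R : comNzRingType) m n :
  fcoef (m%:R : fps R) n = if n == 0%N then m%:R else 0.
Proof.
elim: m => [|m IHm]; first by case: n.
by rewrite -natr1 fcoefD IHm; case: n {IHm} => [|n] /=; rewrite ?natr1 ?addr0.
Qed.

Lemma fcoef_catalan_gf011 n : fcoef (catalan_gf [:: 0; 1; 1]%N) n =
  if n is m.+1 then m.+1%:R + 'C(m, 2)%:R * fpsX int else 1.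
Proof.
apply: fpsP => k; case: n => [|n].
  by rewrite /= catalan_count011_0n; case: k.
rewrite [LHS]/= fcoefD fcoef_natr mulrC fcoef_fpsXM.
case: k => [|[|k]]; rewrite ?fcoef_natr /=.
- by rewrite catalan_count011_S0 addr0 natz.
- by rewrite catalan_count011_S1 add0r natz.
- by rewrite catalan_count011_ge2.
Qed.

Lemma fcoef_mul_1subX (R : comNzRingType) (f : fps R) n :
  fcoef ((1 - fpsX R) * f) n =
  if n is m.+1 then fcoef f m.+1 - fcoef f m else fcoef f 0.
Proof.
rewrite mulrBl mul1r fcoefD fcoefN fcoef_fpsXM.
by case: n => [|n]; rewrite ?subr0.
Qed.

Theorem theorem9 :
  catalan_gf [:: 0; 1; 1]%N =
    (1 - 2 * xvar + 2 * xvar ^+ 2 - xvar ^+ 3 + xvar ^+ 3 * yvar)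
      / (1 - xvar) ^+ 3.
Proof.
have u : (1 - xvar) \is a GRing.unit.
  (* Invertibility is decided by the constant coefficient, and that of [xvar] is 0. *)
  by change (1 - 0 \is a @GRing.unit (fps int)); rewrite subr0 unitr1.
apply: (canRL (mulrK (unitrX 3 u))).
(* Horner form in [xvar], so that coefficients come out by shifts alone. *)
have -> : 1 - 2 * xvar + 2 * xvar ^+ 2 - xvar ^+ 3 + xvar ^+ 3 * yvar =
  1 + xvar * (- 2%:R + xvar * (2%:R + xvar * (yvar - 1))) by ring.
rewrite mulrC exprS expr2 -!mulrA; apply: fpsP => n.
have coefXE := (fcoefD, fcoef_fpsXM, fcoefN, fcoef_natr).
(* The numerator has degree 3 in [xvar], so degrees 0 to 3 are checked one by one. From degree 4 on,
   the third difference no longer meets the exceptional constant coefficient, and Pascal's rule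
   makes it vanish. *)
do 4?[case: n => [|n]]; rewrite ?fcoef_mul_1subX ?fcoef_catalan_gf011 ?coefXE
  /= ?coefXE /=.
- by ring.
- by rewrite bin_small //; ring.
- by rewrite !bin_small //; ring.
- by rewrite binn !bin_small //; ring.
- by rewrite !binS !bin1 !bin0 !natrD; ring.
Qed.
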